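(* Let $n=\frac{p}{q}$, where $p$ is an even integer and $q$ is an odd integer. For $i=1,2$ let $d_i$ be a nonzero real number, let $a_i,b_i$ be real-valued continuous functions on an interval $J$ containing $0$, and let $y_i$ be the unique solution, on an interval $I_i\subseteq J$ containing $0$, of the Bernoulli initial-value problem $$\frac{dy_i(t)}{dt}=a_i(t)y_i(t)+b_i(t)y_i^{n}(t),\qquad y_i(0)=d_i .$$ Then the following hold. (i) If $a_1$ is an even function, $b_1$ is an odd function, $a_2(t)=-a_1(t)$, $b_2(t)=-b_1(t)$, and $d_2=-d_1$, then $y_1$ and $y_2$ are symmetric to each other with respect to the origin, i.e. $y_2(-t)=-y_1(t)$. (ii) If $a_1$ is an odd function, $b_1$ is an even function, $a_2(t)=a_1(t)$, $b_2(t)=b_1(t)$, and $d_2=-d_1$, then $y_1$ and $y_2$ are symmetric to each other with respect to the origin, i.e. $y_2(-t)=-y_1(t)$. (iii) If $a_1$ and $b_1$ are even functions, $a_2(t)=-a_1(t)$, $b_2(t)=b_1(t)$, and $d_2=-d_1$, then $y_1$ and $y_2$ are symmetric to each other with respect to the origin, i.e. $y_2(-t)=-y_1(t)$. (iv) If $a_2(t)=a_1(t)$, $b_2(t)=-b_1(t)$, and $d_2=-d_1$, then $y_1$ and $y_2$ are symmetric to each other with respect to the $t$-axis, i.e. $y_2(t)=-y_1(t)$.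
   Context: Everything is real-valued. For $n=p/q$ with $q>0$ odd, $y^{n}$ means $(y^{1/q})^{p}$ with $y^{1/q}$ the real $q$-th root (so $y^n$ is defined for negative $y$; $y^0=1$; if $n<0$, solutions are nonvanishing). Intervals are nondegenerate; whenever a function on $J$ is said to be even or odd, $J$ is symmetric about $0$. ''The unique solution on $I_i$'' means that $I_i$ is an interval containing $0$ on which the $i$-th initial-value problem has exactly one solution, denoted $y_i$. The identity $y_2(-t)=-y_1(t)$ is understood for all $t$ with $t\in I_1$ and $-t\in I_2$; the identity $y_2(t)=-y_1(t)$ is understood for all $t\in I_1\cap I_2$. *)

(* Defs.v *)
From Stdlib Require Export Reals QArith Lra Lia.
Open Scope R_scope.

(* Meant for odd k, where it is the real k-th root (see [odd_root_spec]).
   The case 0 is separate because Rpower 0 x = exp (x * ln 0) = 1. *)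
Definition odd_root (k : positive) (y : R) : R :=
  if Rlt_dec 0 y then Rpower y (/ INR (Pos.to_nat k))
  else if Rlt_dec y 0 then - Rpower (- y) (/ INR (Pos.to_nat k))
  else 0.

(* A term of type Q is a fraction p # k with k : positive, not necessarily
   reduced; the value is (y^(1/k))^p, the same for all equal fractions with odd k.
   It is a dummy value if n < 0 and y = 0. *)
Definition Qpower_R (y : R) (n : Q) : R :=
  powerRZ (odd_root (Qden n) y) (Qnum n).

Definition is_interval (I : R -> Prop) : Prop :=
  (exists x y : R, I x /\ I y /\ x < y) /\
  (forall x y z : R, I x -> I y -> x <= z <= y -> I z).

Definition included_in (I J : R -> Prop) : Prop := forall t : R, I t -> J t.

Definition continuous_on (J : R -> Prop) (f : R -> R) : Prop :=
  forall t : R, J t -> continue_in f J t.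

Definition symmetric_set (J : R -> Prop) : Prop :=
  forall t : R, J t -> J (- t).

Definition even_on (J : R -> Prop) (f : R -> R) : Prop :=
  symmetric_set J /\ forall t : R, J t -> f (- t) = f t.

Definition odd_on (J : R -> Prop) (f : R -> R) : Prop :=
  symmetric_set J /\ forall t : R, J t -> f (- t) = - f t.

(* Only the values of y on I matter. [D_in] is differentiation relative to I,
   hence one-sided at an endpoint belonging to I. *)
Definition bernoulli_solution (n : Q) (a b : R -> R) (d : R)
    (I : R -> Prop) (y : R -> R) : Prop :=
  y 0 = d /\
  (forall t : R, I t ->
     D_in y (fun s : R => a s * y s + b s * Qpower_R (y s) n) I t) /\
  ((n < 0)%Q -> forall t : R, I t -> y t <> 0).

Definition bernoulli_unique_solution (n : Q) (a b : R -> R) (d : R)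
    (I : R -> Prop) (y : R -> R) : Prop :=
  bernoulli_solution n a b d I y /\
  forall z : R -> R, bernoulli_solution n a b d I z ->
    forall t : R, I t -> z t = y t.

Definition symmetric_wrt_origin (I1 I2 : R -> Prop) (y1 y2 : R -> R) : Prop :=
  forall t : R, I1 t -> I2 (- t) -> y2 (- t) = - y1 t.

Definition symmetric_wrt_axis (I1 I2 : R -> Prop) (y1 y2 : R -> R) : Prop :=
  forall t : R, I1 t -> I2 t -> y2 t = - y1 t.

Lemma pow_opp_odd (k : positive) (x : R) : Z.Odd (Zpos k) ->
  (- x) ^ Pos.to_nat k = - x ^ Pos.to_nat k.
Proof.
intros [m Hm].
assert (E : Pos.to_nat k = S (2 * Z.to_nat m)) by lia.
rewrite E, <- !tech_pow_Rmult, !pow_mult.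
replace ((- x) ^ 2) with (x ^ 2) by ring.
ring.
Qed.

Lemma odd_root_spec (k : positive) (x y : R) : Z.Odd (Zpos k) ->
  odd_root k y = x <-> x ^ Pos.to_nat k = y.
Proof.
intros Hk.
assert (H0 : INR (Pos.to_nat k) <> 0) by (apply not_0_INR; lia).
assert (P0 : 0 ^ Pos.to_nat k = 0) by (apply pow_i; lia).
assert (A : forall u, 0 < u ->
          Rpower u (/ INR (Pos.to_nat k)) ^ Pos.to_nat k = u).
{ intros u Hu. rewrite <- Rpower_pow by apply exp_pos.
  rewrite Rpower_mult, Rinv_l, Rpower_1; auto. }
assert (B : forall u, 0 < u ->
          Rpower (u ^ Pos.to_nat k) (/ INR (Pos.to_nat k)) = u).
{ intros u Hu. rewrite <- Rpower_pow by assumption.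
  rewrite Rpower_mult, Rinv_r, Rpower_1; auto. }
unfold odd_root; split; intros <-.
- destruct (Rlt_dec 0 y) as [h|h]; [now apply A|].
  destruct (Rlt_dec y 0) as [h'|h'].
  + rewrite pow_opp_odd, A by (assumption || lra). ring.
  + rewrite P0. lra.
- destruct (Rtotal_order x 0) as [h|[->|h]].
  + assert (hp : 0 < (- x) ^ Pos.to_nat k) by (apply pow_lt; lra).
    rewrite pow_opp_odd in hp by assumption.
    destruct (Rlt_dec 0 (x ^ Pos.to_nat k)); [lra|].
    destruct (Rlt_dec (x ^ Pos.to_nat k) 0); [|lra].
    rewrite <- pow_opp_odd, B by (assumption || lra). ring.
  + rewrite P0. destruct (Rlt_dec 0 0); [lra|]. reflexivity.
  + assert (hp : 0 < x ^ Pos.to_nat k) by (apply pow_lt; lra).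
    destruct (Rlt_dec 0 (x ^ Pos.to_nat k)); [now apply B|lra].
Qed.

(* Main.v *)
Require Import Defs.
From Stdlib Require Import Classical.

(** Since [p] is even, [y^n] does not change when [y] is replaced by [- y].  So,
    for a sign [s = 1] or [s = -1], the substitution [z t = - y (s * t)] turns a
    Bernoulli equation into another Bernoulli equation, with coefficients
    [s * a (s * t)] and [- s * b (s * t)] ([reflect_solution]).  In the first three
    claims with [s = -1], and in the last with [s = 1], the assumptions say exactly
    that this turns the second problem into the first one.

    Hence [y1] and the reflected [y2] are unique solutions of one problem, but on
    two different intervals [A] and [B], and it remains to see that they agree on
    their intersection.  Uniqueness on an interval does not pass to a smaller
    interval by definition, and for [0 < n < 1] the equation is not Lipschitz at
    zeros of [y], so the local uniqueness theorem would not do either.  Instead,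
    one looks at one side of [0] at a time: there one of the intervals
    contains the other ([one_sided_nesting]).  If [A] is the smaller one on that
    side, replacing the first solution by the second one on that side only
    gives a function that still solves the problem on all of [A]
    ([graft_solution]): at [0] both pieces have the same value, hence by the
    equation the same one-sided derivative.  Uniqueness on [A] then forces
    agreement on that side ([unique_solutions_agree]). *)

(** * Parity of the rational power *)

Lemma odd_root_opp (k : positive) (y : R) : odd_root k (- y) = - odd_root k y.
Proof.
unfold odd_root.
destruct (Rlt_dec 0 (- y)), (Rlt_dec (- y) 0), (Rlt_dec 0 y), (Rlt_dec y 0);
  try lra; rewrite ?Ropp_involutive; reflexivity.
Qed.

Lemma powerRZ_opp_even (x : R) (m : Z) : Z.Even m ->
  powerRZ (- x) m = powerRZ x m.
Proof.
assert (P : forall k : nat, Nat.Even k -> (- x) ^ k = x ^ k).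
{ intros k [j ->]. rewrite !pow_mult. f_equal. ring. }
intros [j Hj]. destruct m as [|k|k]; simpl; [reflexivity| |];
  rewrite P by (exists (Z.to_nat (Z.abs j)); lia); reflexivity.
Qed.

Lemma Qpower_R_opp (n : Q) (y : R) : Z.Even (Qnum n) ->
  Qpower_R (- y) n = Qpower_R y n.
Proof.
intros Hn. unfold Qpower_R. now rewrite odd_root_opp, powerRZ_opp_even.
Qed.

Lemma Qnum_div_even (p q : Z) : Z.Even p -> Z.Odd q ->
  Z.Even (Qnum (inject_Z p / inject_Z q)).
Proof.
intros [j ->] [i Hi]. unfold Qdiv, Qmult. destruct q as [|k|k]; cbn [Qnum Qinv inject_Z].
- lia.
- exists j. now rewrite Z.mul_1_r.
- exists (- j)%Z. change (2 * j * -1 = 2 * - j)%Z. ring.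
Qed.

(** * Reflection of Bernoulli problems *)

Lemma reflect_solution (n : Q) (a b a' b' : R -> R) (d s : R)
    (I I' : R -> Prop) (y : R -> R) :
  Z.Even (Qnum n) -> s = 1 \/ s = -1 ->
  (forall t, I' t -> I (s * t)) ->
  (forall t, I' t -> a' t = s * a (s * t)) ->
  (forall t, I' t -> b' t = - s * b (s * t)) ->
  bernoulli_solution n a b d I y ->
  bernoulli_solution n a' b' (- d) I' (fun t => - y (s * t)).
Proof.
intros Hn Hs HI Ha Hb (H0 & HD & Hnz). split; [|split].
- now rewrite Rmult_0_r, H0.
- intros t Ht eps Heps.
  destruct (HD (s * t) (HI t Ht) eps Heps) as (alp & Halp & H).
  exists alp. split; [exact Halp|].
  intros x [[Hx Hxt] Hdist].
  specialize (H (s * x)). simpl in *. unfold Rdist in *.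
  rewrite Qpower_R_opp, Ha, Hb by assumption.
  assert (As : Rabs s = 1).
  { destruct Hs as [-> | ->]; [apply Rabs_R1|]. rewrite Rabs_left; lra. }
  replace ((- y (s * x) - - y (s * t)) / (x - t)
           - (s * a (s * t) * - y (s * t)
              + - s * b (s * t) * Qpower_R (y (s * t)) n))
    with (- s * ((y (s * x) - y (s * t)) / (s * x - s * t)
           - (a (s * t) * y (s * t) + b (s * t) * Qpower_R (y (s * t)) n)))
    by (destruct Hs as [-> | ->]; field; lra).
  rewrite Rabs_mult, Rabs_Ropp, As, Rmult_1_l.
  apply H. split.
  + split; [now apply HI|]. intros E. apply Hxt.
    destruct Hs as [-> | ->]; lra.
  + replace (s * x - s * t) with (s * (x - t)) by ring.
    now rewrite Rabs_mult, As, Rmult_1_l.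
- intros Hneg t Ht E. apply (Hnz Hneg (s * t) (HI t Ht)). lra.
Qed.

(** Uniqueness is transported because reflecting twice with the same sign gives
    back the original function. *)
Lemma reflect_unique_solution (n : Q) (a b a' b' : R -> R) (d s : R)
    (I : R -> Prop) (y : R -> R) :
  Z.Even (Qnum n) -> s = 1 \/ s = -1 ->
  (forall t, I (s * t) -> a' t = s * a (s * t)) ->
  (forall t, I (s * t) -> b' t = - s * b (s * t)) ->
  bernoulli_unique_solution n a b d I y ->
  bernoulli_unique_solution n a' b' (- d) (fun t => I (s * t))
    (fun t => - y (s * t)).
Proof.
intros Hn Hs Ha Hb [Hy Huniq].
assert (ss : forall t, s * (s * t) = t) by (intros t; destruct Hs as [-> | ->]; ring).
split.
- apply (reflect_solution n a b a' b' d s I); auto.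
- intros z Hz t Ht.
  assert (E : - z (s * (s * t)) = y (s * t)).
  { apply (Huniq (fun r => - z (s * r))); [|exact Ht].
    rewrite <- (Ropp_involutive d).
    apply (reflect_solution n a' b' a b (- d) s (fun r => I (s * r))); auto.
    - intros r Hr. now rewrite ss.
    - intros r Hr. rewrite Ha, !ss by now rewrite ss.
      destruct Hs as [-> | ->]; ring.
    - intros r Hr. rewrite Hb, !ss by now rewrite ss.
      destruct Hs as [-> | ->]; ring. }
  rewrite ss in E. lra.
Qed.

(** * Grafting one solution onto another *)

Lemma D_in_locally_eq (f g h h' : R -> R) (A B : R -> Prop) (t r : R) :
  0 < r ->
  (forall x, A x -> Rabs (x - t) < r -> B x /\ f x = g x) ->
  f t = g t -> h t = h' t -> D_in g h' B t -> D_in f h A t.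
Proof.
intros Hr Hloc Ht Hh HD eps Heps.
destruct (HD eps Heps) as (alp & Halp & H).
exists (Rmin alp r). split; [now apply Rmin_glb_lt|].
intros x [[Hx Hxt] Hdist]. simpl in *. unfold Rdist in *.
pose proof (Rmin_l alp r). pose proof (Rmin_r alp r).
destruct (Hloc x Hx ltac:(lra)) as [HB E].
rewrite E, Ht, Hh. apply H. repeat split; auto; lra.
Qed.

Lemma D_in_union (f h : R -> R) (A B C : R -> Prop) (t : R) :
  (forall x, C x -> A x \/ B x) ->
  D_in f h A t -> D_in f h B t -> D_in f h C t.
Proof.
intros HC HA HB eps Heps.
destruct (HA eps Heps) as (alp & Halp & H).
destruct (HB eps Heps) as (bet & Hbet & H').
exists (Rmin alp bet). split; [now apply Rmin_glb_lt|].
intros x [[Hx Hxt] Hdist]. simpl in *.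
pose proof (Rmin_l alp bet). pose proof (Rmin_r alp bet).
destruct (HC x Hx); [apply H | apply H']; repeat split; auto; lra.
Qed.

(** The side of [0] on which [v] is used is the one containing [c]; encoding the
    side by the sign of [c * x] treats both sides at once. *)
Definition graft (c : R) (u v : R -> R) (x : R) : R :=
  if Rlt_dec (c * x) 0 then u x else v x.

Lemma same_sign_nearby (c t : R) : c * t <> 0 ->
  forall x, Rabs (x - t) < Rabs t -> 0 < (c * t) * (c * x).
Proof.
intros Hct x Hx.
assert (Hc : c <> 0) by (intros ->; lra).
assert (0 < c * c) by nra.
assert (0 < t * x).
{ revert Hx. unfold Rabs.
  destruct (Rcase_abs (x - t)), (Rcase_abs t); intros; nra. }
nra.
Qed.

Lemma graft_solution (n : Q) (a b : R -> R) (d c : R) (A B : R -> Prop)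
    (u v : R -> R) :
  c <> 0 ->
  (forall x, A x -> 0 <= c * x -> B x) ->
  bernoulli_solution n a b d A u ->
  bernoulli_solution n a b d B v ->
  bernoulli_solution n a b d A (graft c u v).
Proof.
intros Hc HAB (Hu0 & HuD & Hunz) (Hv0 & HvD & Hvnz).
assert (Gu : forall x, c * x <= 0 -> graft c u v x = u x).
{ intros x Hx. unfold graft. destruct (Rlt_dec (c * x) 0); [reflexivity|].
  assert (x = 0) by nra. subst x. congruence. }
assert (Gv : forall x, 0 <= c * x -> graft c u v x = v x).
{ intros x Hx. unfold graft. destruct (Rlt_dec (c * x) 0); [lra|reflexivity]. }
split; [|split].
- rewrite Gv by lra. exact Hv0.
- intros t Ht.
  destruct (Rtotal_order (c * t) 0) as [Hct|[Hct|Hct]].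
  + pose proof (same_sign_nearby c t ltac:(lra)) as Hnear.
    apply (D_in_locally_eq _ u _ _ A A t (Rabs t)) with (5 := HuD t Ht).
    * apply Rabs_pos_lt. intros ->. lra.
    * intros x Hx Hxt. specialize (Hnear x Hxt). split; [exact Hx|].
      apply Gu. nra.
    * apply Gu. lra.
    * simpl. now rewrite Gu by lra.
  + (* [t = 0]: each side separately is a side of a genuine solution. *)
    apply (D_in_union _ _ (fun x => A x /\ c * x <= 0)
                          (fun x => A x /\ 0 <= c * x)).
    * intros x Hx. destruct (Rle_dec (c * x) 0); [left | right]; split; auto; lra.
    * apply (D_in_locally_eq _ u _ _ _ A t 1) with (5 := HuD t Ht).
      -- lra.
      -- intros x [Hx Hcx] _. auto.
      -- apply Gu. lra.
      -- simpl. now rewrite Gu by lra.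
    * apply (D_in_locally_eq _ v _ _ _ B t 1)
        with (5 := HvD t (HAB t Ht ltac:(lra))).
      -- lra.
      -- intros x [Hx Hcx] _. auto.
      -- apply Gv. lra.
      -- simpl. now rewrite Gv by lra.
  + pose proof (same_sign_nearby c t ltac:(lra)) as Hnear.
    apply (D_in_locally_eq _ v _ _ A B t (Rabs t))
      with (5 := HvD t (HAB t Ht ltac:(lra))).
    * apply Rabs_pos_lt. intros ->. lra.
    * intros x Hx Hxt. specialize (Hnear x Hxt).
      assert (0 <= c * x) by nra. auto.
    * apply Gv. lra.
    * simpl. now rewrite Gv by lra.
- intros Hneg t Ht. destruct (Rle_dec (c * t) 0).
  + rewrite Gu by assumption. auto.
  + rewrite Gv by lra. apply Hvnz; [assumption|]. apply HAB; [assumption|lra].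
Qed.

(** * Unique solutions on different intervals *)

Lemma one_sided_nesting (c : R) (A B : R -> Prop) :
  is_interval A -> A 0 -> is_interval B -> B 0 -> c <> 0 ->
  (forall x, A x -> 0 <= c * x -> B x) \/
  (forall x, B x -> 0 <= c * x -> A x).
Proof.
intros [_ HA] A0 [_ HB] B0 Hc.
destruct (classic (forall x, A x -> 0 <= c * x -> B x)) as [|Hnot]; [now left|].
right. intros r Hr Hcr.
apply not_all_ex_not in Hnot. destruct Hnot as [x Hx].
apply imply_to_and in Hx. destruct Hx as [Ax Hx].
apply imply_to_and in Hx. destruct Hx as [Hcx NBx].
(* [x] is outside [B], so it lies beyond [r] on the same side of [0]. *)
destruct (Rlt_dec 0 c).
- assert (0 <= x) by nra. assert (0 <= r) by nra.
  destruct (Rle_dec x r); [|apply (HA 0 x); auto; lra].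
  destruct NBx. apply (HB 0 r); auto.
- assert (x <= 0) by nra. assert (r <= 0) by nra.
  destruct (Rle_dec r x); [|apply (HA x 0); auto; lra].
  destruct NBx. apply (HB r 0); auto.
Qed.

Lemma unique_solutions_agree (n : Q) (a b : R -> R) (d : R)
    (A B : R -> Prop) (u v : R -> R) :
  is_interval A -> A 0 -> is_interval B -> B 0 ->
  bernoulli_unique_solution n a b d A u ->
  bernoulli_unique_solution n a b d B v ->
  forall t, A t -> B t -> u t = v t.
Proof.
intros HA A0 HB B0 [Hu Uu] [Hv Uv] t At Bt.
destruct (Req_dec t 0) as [->|Ht].
- now rewrite (proj1 Hu), (proj1 Hv).
- assert (G : forall f g, graft t f g t = g t).
  { intros f g. unfold graft. destruct (Rlt_dec (t * t) 0); [nra|reflexivity]. }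
  (* The side to be replaced is the one of [t] itself. *)
  destruct (one_sided_nesting t A B HA A0 HB B0 Ht) as [N|N].
  + rewrite <- (Uu (graft t u v)), G; auto.
    now apply (graft_solution n a b d t A B).
  + rewrite <- (Uv (graft t v u)), G; auto.
    now apply (graft_solution n a b d t B A).
Qed.

(** * Symmetry of the unique solutions *)

Lemma reflect_interval (s : R) (I : R -> Prop) : s = 1 \/ s = -1 ->
  is_interval I -> is_interval (fun t => I (s * t)).
Proof.
intros Hs [(x & y & Hx & Hy & Hxy) HI]. split.
- destruct Hs as [-> | ->].
  + exists x, y. rewrite !Rmult_1_l. auto.
  + exists (- y), (- x).
    replace (-1 * - y) with y by ring. replace (-1 * - x) with x by ring.
    repeat split; auto; lra.
- intros x' y' z' Hx' Hy' Hz'. destruct Hs as [-> | ->].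
  + apply (HI _ _ _ Hx' Hy'). lra.
  + apply (HI _ _ _ Hy' Hx'). lra.
Qed.

(** All four symmetries at once: [s = -1] is the symmetry with respect to the
    origin and [s = 1] the one with respect to the axis. *)
Lemma reflected_solutions_agree (n : Q) (a1 b1 a2 b2 : R -> R) (d1 d2 s : R)
    (I1 I2 : R -> Prop) (y1 y2 : R -> R) :
  Z.Even (Qnum n) -> s = 1 \/ s = -1 ->
  is_interval I1 -> I1 0 -> is_interval I2 -> I2 0 ->
  bernoulli_unique_solution n a1 b1 d1 I1 y1 ->
  bernoulli_unique_solution n a2 b2 d2 I2 y2 ->
  d2 = - d1 ->
  (forall t, I2 (s * t) -> a1 t = s * a2 (s * t)) ->
  (forall t, I2 (s * t) -> b1 t = - s * b2 (s * t)) ->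
  forall t, I1 t -> I2 (s * t) -> y2 (s * t) = - y1 t.
Proof.
intros Hn Hs HI1 H10 HI2 H20 Hy1 Hy2 Hd Ha Hb t Ht1 Ht2.
assert (Hd1 : - d2 = d1) by lra.
pose proof (reflect_unique_solution n a2 b2 a1 b1 d2 s I2 y2 Hn Hs Ha Hb Hy2) as Hz.
rewrite Hd1 in Hz.
assert (E : y1 t = - y2 (s * t)).
{ apply (unique_solutions_agree n a1 b1 d1 I1 (fun r => I2 (s * r)) y1
           (fun r => - y2 (s * r))); auto.
  - now apply reflect_interval.
  - now rewrite Rmult_0_r. }
lra.
Qed.

Theorem theorem2
  (p q : Z) (hp : Z.Even p) (hq : Z.Odd q)
  (n : Q) (hn : n = (inject_Z p / inject_Z q)%Q)
  (J : R -> Prop) (hJ : is_interval J) (hJ0 : J 0)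
  (d1 d2 : R) (hd1 : d1 <> 0) (hd2 : d2 <> 0)
  (a1 b1 a2 b2 : R -> R)
  (ha1 : continuous_on J a1) (hb1 : continuous_on J b1)
  (ha2 : continuous_on J a2) (hb2 : continuous_on J b2)
  (I1 I2 : R -> Prop)
  (hI1 : is_interval I1) (hI10 : I1 0) (hI1J : included_in I1 J)
  (hI2 : is_interval I2) (hI20 : I2 0) (hI2J : included_in I2 J)
  (y1 y2 : R -> R)
  (hy1 : bernoulli_unique_solution n a1 b1 d1 I1 y1)
  (hy2 : bernoulli_unique_solution n a2 b2 d2 I2 y2) :
  (even_on J a1 -> odd_on J b1 ->
   (forall t : R, J t -> a2 t = - a1 t) ->
   (forall t : R, J t -> b2 t = - b1 t) ->
   d2 = - d1 ->
   symmetric_wrt_origin I1 I2 y1 y2) /\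
  (odd_on J a1 -> even_on J b1 ->
   (forall t : R, J t -> a2 t = a1 t) ->
   (forall t : R, J t -> b2 t = b1 t) ->
   d2 = - d1 ->
   symmetric_wrt_origin I1 I2 y1 y2) /\
  (even_on J a1 -> even_on J b1 ->
   (forall t : R, J t -> a2 t = - a1 t) ->
   (forall t : R, J t -> b2 t = b1 t) ->
   d2 = - d1 ->
   symmetric_wrt_origin I1 I2 y1 y2) /\
  ((forall t : R, J t -> a2 t = a1 t) ->
   (forall t : R, J t -> b2 t = - b1 t) ->
   d2 = - d1 ->
   symmetric_wrt_axis I1 I2 y1 y2).
Proof.
assert (Hn : Z.Even (Qnum n)) by (rewrite hn; now apply Qnum_div_even).
assert (opp : forall t, - t = -1 * t) by (intros t; ring).
assert (J2 : forall t, symmetric_set J -> I2 (-1 * t) -> J t /\ J (- t)).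
{ intros t HS Ht. rewrite <- opp in Ht. apply hI2J in Ht.
  split; [rewrite <- (Ropp_involutive t); now apply HS | exact Ht]. }
split; [|split; [|split]].
- intros [HS Ea] [_ Ob] Ha Hb Hd t Ht1 Ht2. rewrite (opp t) in *.
  apply (reflected_solutions_agree n a1 b1 a2 b2 d1 d2 (-1) I1 I2); auto;
    intros r Hr; destruct (J2 r HS Hr); rewrite <- (opp r).
  + rewrite Ha, Ea by assumption. ring.
  + rewrite Hb, Ob by assumption. ring.
- intros [HS Oa] [_ Eb] Ha Hb Hd t Ht1 Ht2. rewrite (opp t) in *.
  apply (reflected_solutions_agree n a1 b1 a2 b2 d1 d2 (-1) I1 I2); auto;
    intros r Hr; destruct (J2 r HS Hr); rewrite <- (opp r).
  + rewrite Ha, Oa by assumption. ring.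
  + rewrite Hb, Eb by assumption. ring.
- intros [HS Ea] [_ Eb] Ha Hb Hd t Ht1 Ht2. rewrite (opp t) in *.
  apply (reflected_solutions_agree n a1 b1 a2 b2 d1 d2 (-1) I1 I2); auto;
    intros r Hr; destruct (J2 r HS Hr); rewrite <- (opp r).
  + rewrite Ha, Ea by assumption. ring.
  + rewrite Hb, Eb by assumption. ring.
- intros Ha Hb Hd t Ht1 Ht2. rewrite <- (Rmult_1_l t) in Ht2.
  rewrite <- (Rmult_1_l t) at 1.
  apply (reflected_solutions_agree n a1 b1 a2 b2 d1 d2 1 I1 I2); auto;
    intros r Hr; apply hI2J in Hr; rewrite Rmult_1_l in Hr; rewrite !Rmult_1_l.
  + rewrite Ha by assumption. ring.
  + rewrite Hb by assumption. ring.
Qed.
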